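(* Let $A_1,B_1,C_1,L_1,A_2,L_2,\Gamma_1,\Gamma_2$ be real matrices of compatible dimensions such that $$A:=\begin{bmatrix}A_1 & L_1\Gamma_2\\ L_2\Gamma_1 & A_2\end{bmatrix}$$ is stable. Consider the preexisting system $$\Sigma:\quad \dot x_1=A_1x_1+L_1\gamma_2+B_1u_1,\quad \dot x_2=A_2x_2+L_2\Gamma_1x_1,\quad \gamma_2=\Gamma_2x_2,\quad y_1=C_1x_1,$$ with initial condition $x_1(0)=\delta_0$, $x_2(0)=0$. Let $\epsilon_1>0$ and let $K_1$ be any feedback gain such that the dynamics $\dot{\hat\xi}_1=(A_1+B_1K_1C_1)\hat\xi_1$ is internally stable and satisfies $$\|\hat\xi_1\|_{\mathcal L_2}\le\epsilon_1\quad\text{for all }\hat\xi_1(0)\in\mathcal B .$$ Then the entire closed-loop system, with state $(x_1,x_2,\hat x_1)$, composed of $\Sigma$ and the controller $$\Pi_1:\quad \dot{\hat x}_1=A_1\hat x_1+L_1\gamma_2,\qquad u_1=K_1(y_1-C_1\hat x_1),\qquad \hat x_1(0)=0,$$ is internally stable, and $$\|x_1\|_{\mathcal L_2}\le\alpha_1\epsilon_1,\qquad \|x_2\|_{\mathcal L_2}\le\alpha_2\epsilon_1\qquad\text{for all }\delta_0\in\mathcal B,$$ where the constants $$\alpha_1:=\|G_1+I\|_{\mathcal H_\infty},\qquad \alpha_2:=\|G_2\|_{\mathcal H_\infty},\qquad G_i(s):=E_i^{\sf T}(sI-A)^{-1}E_2L_2\Gamma_1\quad(i\in\{1,2\})$$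 are independent of the choice of $K_1$.
   Context: The state dimensions are $x_1(t)\in\mathbb R^{n_1}$, $x_2(t)\in\mathbb R^{n_2}$, $\hat x_1(t),\hat\xi_1(t)\in\mathbb R^{n_1}$. $\mathcal B:=\{\delta\in\mathbb R^{n_1}:\|\delta\|\le 1\}$ is the closed Euclidean unit ball. $E_1:=\begin{bmatrix} I \\ 0 \end{bmatrix}$ and $E_2:=\begin{bmatrix} 0 \\ I \end{bmatrix}$ are the block embeddings of $\mathbb R^{n_1}$ and $\mathbb R^{n_2}$ into $\mathbb R^{n_1+n_2}$. A square matrix is stable if all its eigenvalues have negative real part; a linear time-invariant system is internally stable if its (closed-loop) state matrix is stable. $\|f\|_{\mathcal L_2}$ is the $\mathcal L_2$-norm on $[0,\infty)$ of a square-integrable vector-valued function and $\|G\|_{\mathcal H_\infty}$ is the $\mathcal H_\infty$-norm of a stable transfer matrix. *)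

(* Defs.v *)
From mathcomp Require Import all_boot all_order all_algebra.
From mathcomp Require Import all_classical all_reals all_analysis.
From mathcomp Require Import complex.

Set Implicit Arguments.
Unset Strict Implicit.
Unset Printing Implicit Defensive.

Import Order.TTheory GRing.Theory Num.Theory.
Import numFieldNormedType.Exports.

Local Open Scope classical_set_scope.
Local Open Scope ring_scope.

Definition cplx_mx (R : realType) m n (M : 'M[R]_(m, n)) : 'M[R[i]]_(m, n) :=
  map_mx (real_complex R) M.

Definition stable (R : realType) n (M : 'M[R]_n) : Prop :=
  forall z : R[i], eigenvalue (cplx_mx M) z -> complex.Re z < 0.

Definition enorm (R : realType) n (x : 'cV[R]_n) : R :=
  Num.sqrt (\sum_(i < n) x i 0 ^+ 2).

Definition cenorm (R : realType) n (z : 'cV[R[i]]_n) : R :=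
  Num.sqrt (\sum_(i < n) ComplexField.Normc.normc (z i 0) ^+ 2).

(* The L2 norm over [0, +oo[; values of f at negative times are irrelevant. *)
Definition L2norm (R : realType) n (f : R -> 'cV[R]_n) : \bar R :=
  ('N[lebesgue_measure]_(2%:E)
     [EFin \o ((fun t => enorm (f t)) \_ (`[0%R, +oo[%classic))])%E.

(* Induced 2-norm (largest singular value); the set is nonempty and bounded,
   so this real supremum is the true one. *)
Definition opnorm (R : realType) m n (M : 'M[R[i]]_(m, n)) : R :=
  sup [set cenorm (M *m z) | z in [set z : 'cV[R[i]]_n | cenorm z <= 1]].

(* H-infinity norm of a stable transfer matrix: the supremum over frequencies w
   of the largest singular value of G at the point (0 + w i). *)
Definition Hinf_norm (R : realType) m n (G : R[i] -> 'M[R[i]]_(m, n)) : \bar R :=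
  ereal_sup (range (fun w : R => (opnorm (G (Complex 0 w)))%:E)).

(* Solution on [0, +oo[ of x' = v, continuous up to the initial time. *)
Definition solves (R : realType) n (x v : R -> 'cV[R]_n) : Prop :=
  {within `[0, +oo[, continuous x} /\
  (forall t : R, 0 < t -> is_derive t 1 x (v t)).

Definition E1 (R : realType) n1 n2 : 'M[R]_(n1 + n2, n1) := col_mx 1%:M 0.
Definition E2 (R : realType) n1 n2 : 'M[R]_(n1 + n2, n2) := col_mx 0 1%:M.

Definition preexisting_mx (R : realType) n1 n2 q r
    (A1 : 'M[R]_n1) (L1 : 'M[R]_(n1, q)) (A2 : 'M[R]_n2) (L2 : 'M[R]_(n2, r))
    (Gamma1 : 'M[R]_(r, n1)) (Gamma2 : 'M[R]_(q, n2)) : 'M[R]_(n1 + n2) :=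
  block_mx A1 (L1 *m Gamma2) (L2 *m Gamma1) A2.

(* s |-> E^T (s I - A)^-1 E2 L2 Gamma1, to be used with E = E1 and E = E2. *)
Definition transfer (R : realType) n1 n2 r k (E : 'M[R]_(n1 + n2, k))
    (A : 'M[R]_(n1 + n2)) (L2 : 'M[R]_(n2, r)) (Gamma1 : 'M[R]_(r, n1))
    (s : R[i]) : 'M[R[i]]_(k, n1) :=
  cplx_mx E^T *m invmx (s%:M - cplx_mx A) *m cplx_mx (E2 R n1 n2 *m L2 *m Gamma1).

Definition Sigma (R : realType) n1 n2 m p q r
    (A1 : 'M[R]_n1) (B1 : 'M[R]_(n1, m)) (C1 : 'M[R]_(p, n1))
    (L1 : 'M[R]_(n1, q)) (A2 : 'M[R]_n2) (L2 : 'M[R]_(n2, r))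
    (Gamma1 : 'M[R]_(r, n1)) (Gamma2 : 'M[R]_(q, n2)) (delta0 : 'cV[R]_n1)
    (u1 : R -> 'cV[R]_m) (x1 : R -> 'cV[R]_n1) (x2 : R -> 'cV[R]_n2)
    (gamma2 : R -> 'cV[R]_q) (y1 : R -> 'cV[R]_p) : Prop :=
  [/\ solves x1 (fun t => A1 *m x1 t + L1 *m gamma2 t + B1 *m u1 t),
      solves x2 (fun t => A2 *m x2 t + L2 *m Gamma1 *m x1 t),
      forall t, 0 <= t -> gamma2 t = Gamma2 *m x2 t,
      forall t, 0 <= t -> y1 t = C1 *m x1 t &
      x1 0 = delta0 /\ x2 0 = 0].

Definition Pi1 (R : realType) n1 m p q
    (A1 : 'M[R]_n1) (C1 : 'M[R]_(p, n1)) (L1 : 'M[R]_(n1, q))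
    (K1 : 'M[R]_(m, p)) (gamma2 : R -> 'cV[R]_q) (y1 : R -> 'cV[R]_p)
    (xh1 : R -> 'cV[R]_n1) (u1 : R -> 'cV[R]_m) : Prop :=
  [/\ solves xh1 (fun t => A1 *m xh1 t + L1 *m gamma2 t),
      forall t, 0 <= t -> u1 t = K1 *m (y1 t - C1 *m xh1 t) &
      xh1 0 = 0].

(* State matrix of the interconnection of Sigma and Pi1 for the state
   (x1, x2, xh1), obtained by eliminating u1, y1 and gamma2; closed_loop_mxE
   checks it against the equations of Sigma and Pi1. *)
Definition closed_loop_mx (R : realType) n1 n2 m p q r
    (A1 : 'M[R]_n1) (B1 : 'M[R]_(n1, m)) (C1 : 'M[R]_(p, n1))
    (L1 : 'M[R]_(n1, q)) (A2 : 'M[R]_n2) (L2 : 'M[R]_(n2, r))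
    (Gamma1 : 'M[R]_(r, n1)) (Gamma2 : 'M[R]_(q, n2)) (K1 : 'M[R]_(m, p)) :
    'M[R]_(n1 + n2 + n1) :=
  block_mx
    (block_mx (A1 + B1 *m K1 *m C1) (L1 *m Gamma2)
              (L2 *m Gamma1)        A2)
    (col_mx (- (B1 *m K1 *m C1)) 0)
    (row_mx 0 (L1 *m Gamma2)) A1.

Lemma closed_loop_mxE (R : realType) n1 n2 m p q r
    (A1 : 'M[R]_n1) (B1 : 'M[R]_(n1, m)) (C1 : 'M[R]_(p, n1))
    (L1 : 'M[R]_(n1, q)) (A2 : 'M[R]_n2) (L2 : 'M[R]_(n2, r))
    (Gamma1 : 'M[R]_(r, n1)) (Gamma2 : 'M[R]_(q, n2)) (K1 : 'M[R]_(m, p))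
    (x1 xh1 : 'cV[R]_n1) (x2 : 'cV[R]_n2) :
  let gamma2 := Gamma2 *m x2 in
  let u1 := K1 *m (C1 *m x1 - C1 *m xh1) in
  closed_loop_mx A1 B1 C1 L1 A2 L2 Gamma1 Gamma2 K1
    *m col_mx (col_mx x1 x2) xh1 =
  col_mx (col_mx (A1 *m x1 + L1 *m gamma2 + B1 *m u1)
                 (A2 *m x2 + L2 *m Gamma1 *m x1))
         (A1 *m xh1 + L1 *m gamma2).
Proof.
rewrite /= /closed_loop_mx mul_block_col mul_block_col mul_col_mx mul_row_col.
rewrite !mul0mx add0r add_col_mx addr0 mulNmx mulmxDl !mulmxBr !mulmxA.
congr col_mx; last by rewrite addrC.
congr col_mx; last by rewrite addrC.
by rewrite -!addrA; congr (_ + _); rewrite addrA [RHS]addrCA !addrA.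
Qed.

(* Main.v *)
Require Import Defs.
From mathcomp Require Import all_boot all_order all_algebra cyclic separable cyclotomic.
From mathcomp Require Import all_classical all_reals all_analysis.
From mathcomp Require Import complex ring lra.

(** In the coordinates (x1, x2, xh1) the closed loop is autonomous. The error
    e = x1 - xh1 solves e' = (A1 + B1 K1 C1) e with e(0) = delta0, hence has L2
    norm at most eps1, and it drives (xh1, x2) through the preexisting system:
    in the frequency domain x1 = (G1 + I) e and x2 = G2 e.

    Plancherel's theorem is replaced by Lyapunov equations. For w' = F w with F
    stable and F^T P + P F = - Q, the energy int w^T Q w is v^T P v with
    v = w(0), and r = (s - F)^-1 v with s imaginary satisfies
    r^* Q r = v^* P r + r^* P v. Put s = (z - 1) / (z + 1) and average this
    identity, with weight |1 - s|^2, over the N-th roots of unity z, N odd: with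
    X the Cayley transform of F, the average of z (z - X)^-1 is (1 - X^N)^-1,
    which tends to 1 as N grows, and the right-hand side tends to 2 v^T P v.
    So a quadratic form that is nonnegative at all frequencies has nonnegative
    energy; apply this to Q = alpha^2 U^T U - H^T H, where H w is the output and
    U w = e. *)

Set Implicit Arguments.
Unset Strict Implicit.
Unset Printing Implicit Defensive.

Import Order.TTheory GRing.Theory Num.Theory.
Import numFieldNormedType.Exports.

Local Open Scope classical_set_scope.
Local Open Scope ring_scope.
Import ComplexField.Normc.

(** * Powers of a complex matrix with spectrum in the open unit disc *)

Lemma normc_norm (R : realType) (z : R[i]) : `|z| = (normc z)%:C%C.
Proof. by case: z. Qed.

Lemma normc_ge0 (R : realType) (z : R[i]) : 0 <= normc z.
Proof. by case: z => a b; rewrite /normc sqrtr_ge0. Qed.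

Lemma normc_sum (R : realType) (I : Type) (s : seq I) (f : I -> R[i]) :
  normc (\sum_(i <- s) f i) <= \sum_(i <- s) normc (f i).
Proof.
elim: s => [|i s IH]; first by rewrite !big_nil normc0.
by rewrite !big_cons (le_trans (le_normcD _ _)) // lerD2l.
Qed.

(** The rate [(1 + mu) / 2] lies strictly above both [normc l] and [rho], so the forcing is absorbed
    even when these two coincide and resonance would bring in a factor [N]. The leading constant
    [K'] satisfies [K <= K' * ((1 - mu) / 2)]: one step contracts the old bound by [mu] and the
    forcing adds back at most (1 - mu) / 2 of it. *)
Lemma affine_recurrence_decay (R : realType) (l : R[i]) (a b : nat -> R[i]) (K rho : R) :
  normc l < 1 -> 0 <= K -> 0 <= rho < 1 ->
  (forall N, a N.+1 = l * a N + b N) ->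
  (forall N, normc (b N) <= K * rho ^+ N) ->
  forall N, normc (a N) <=
    (normc (a 0%N) + 2 * K / (1 - Num.max (normc l) rho)) *
    ((1 + Num.max (normc l) rho) / 2) ^+ N.
Proof.
move=> l1 K0 /andP[rho0 rho1] aS bK.
set mu := Num.max _ _.
have mu1 : mu < 1 by rewrite gt_max l1.
have lmu : normc l <= mu by rewrite le_max lexx.
have rmu : rho <= mu by rewrite le_max lexx orbT.
have mu0 : 0 <= mu := le_trans rho0 rmu.
set K' := _ + _.
have K'K : K <= K' * ((1 - mu) / 2).
  rewrite /K' mulrDl -[2 * K / _ * _]mulrA [X in _ + X](_ : _ = K); last first.
    by field; rewrite subr_eq0 gt_eqF.
  by rewrite lerDr mulr_ge0 ?normc_ge0 // divr_ge0 // subr_ge0 ltW.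
have K'0 : 0 <= K'.
  by rewrite addr_ge0 ?normc_ge0 // divr_ge0 ?mulr_ge0 // subr_ge0 ltW.
elim=> [|N IH].
  by rewrite expr0 mulr1 lerDl divr_ge0 ?mulr_ge0 // subr_ge0 ltW.
rewrite aS (le_trans (le_normcD _ _)) // normcM.
set s := (1 + mu) / 2 in IH *.
have rs : rho <= s by rewrite /s; lra.
have sN : 0 <= s ^+ N by rewrite exprn_ge0 // (le_trans rho0).
have h1 : normc l * normc (a N) <= mu * (K' * s ^+ N).
  by rewrite ler_pM ?normc_ge0.
have h2 : normc (b N) <= K' * ((1 - mu) / 2) * s ^+ N.
  by rewrite (le_trans (bK N)) // ler_pM ?exprn_ge0 // lerXn2r // nnegrE (le_trans rho0).
rewrite (le_trans (lerD h1 h2)) // le_eqVlt; apply/orP; left; apply/eqP.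
by rewrite exprS /s; field.
Qed.

(** Induction on the factors: once (X - l) U decays, the entries of [X ^+ N *m U] obey an affine
    recurrence of ratio [l]. The matrix [U] is arbitrary so that a factor can be moved into it. *)
Lemma annihilated_pow_decay (R : realType) n k (X : 'M[R[i]]_n.+1)
    (rs : seq R[i]) (U : 'M[R[i]]_(n.+1, k)) :
  (forall l, l \in rs -> normc l < 1) ->
  horner_mx X (\prod_(l <- rs) ('X - l%:P)) *m U = 0 ->
  exists K rho : R, [/\ 0 <= K, 0 <= rho < 1 &
    forall N i j, normc ((X ^+ N *m U) i j) <= K * rho ^+ N].
Proof.
elim: rs U => [|l rs IH] U hrs.
  rewrite big_nil rmorph1 mul1mx => ->; exists 0, 0; split => // [|N i j].
    by rewrite lexx ltr01.
  by rewrite mulmx0 mxE normc0 mul0r.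
rewrite big_cons mulrC rmorphM /= -mulmxA => hU.
have [|K [rho [K0 rho01 hK]]] := IH _ _ hU.
  by move=> x xrs; apply: hrs; rewrite inE xrs orbT.
have l1 : normc l < 1 by apply: hrs; rewrite inE eqxx.
set mu := Num.max (normc l) rho.
have mu1 : mu < 1 by rewrite gt_max l1; case/andP: rho01.
have mu0 : 0 <= mu by rewrite le_max normc_ge0.
(* The double sum dominates every initial entry, which makes the constant uniform in [i] and [j]. *)
exists (\sum_i \sum_j normc (U i j) + 2 * K / (1 - mu)), ((1 + mu) / 2); split.
- apply: addr_ge0; last by rewrite divr_ge0 ?mulr_ge0 ?subr_ge0 // ltW.
  by apply: sumr_ge0 => i _; apply: sumr_ge0 => j _; apply: normc_ge0.
- by apply/andP; split; lra.
- move=> N i j.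
  have aS M : (X ^+ M.+1 *m U) i j = l * (X ^+ M *m U) i j +
      (X ^+ M *m (horner_mx X ('X - l%:P) *m U)) i j.
    rewrite rmorphB /= horner_mx_X horner_mx_C mulmxBl mulmxBr mul_scalar_mx.
    rewrite -scalemxAr mulmxA exprSr.
    have E (Y Z : 'M[R[i]]_(n.+1, k)) : Y i j = l * Z i j + (Y - l *: Z) i j.
      by rewrite !mxE; ring.
    exact: E.
  apply: (le_trans (affine_recurrence_decay (a := fun M => (X ^+ M *m U) i j)
    l1 K0 rho01 aS _ N)).
    by move=> M; apply: hK.
  rewrite -/mu; apply: ler_wpM2r; first by apply: exprn_ge0; lra.
  rewrite lerD2r expr0 mul1mx (bigD1 i) //= (bigD1 j) //=.
  rewrite -addrA lerDl addr_ge0 //; first by apply: sumr_ge0 => ? _; apply: normc_ge0.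
  by apply: sumr_ge0 => ? _; apply: sumr_ge0 => ? _; apply: normc_ge0.
Qed.

Lemma geometric_lt (R : realType) (K rho e : R) : 0 <= rho < 1 -> 0 < e ->
  exists N0 : nat, forall N, (N0 <= N)%N -> K * rho ^+ N < e.
Proof.
move=> /andP[r0 r1] e0.
have h : (fun N => K * rho ^+ N) @ \oo --> (0 : R).
  rewrite -[X in _ --> X](mulr0 K); apply: cvgMr; apply: cvg_expr.
  by rewrite ger0_norm.
have /cvgrPdist_lt /(_ e e0) [N0 _ hN] := h.
exists N0 => N hN0; have := hN N hN0; rewrite /= sub0r normrN.
by apply: le_lt_trans; apply: ler_norm.
Qed.

(* Cayley-Hamilton: the factors X - l are peeled off one at a time. *)
Lemma pow_decay (R : realType) n (X : 'M[R[i]]_n) :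
  (forall l, eigenvalue X l -> normc l < 1) ->
  forall e : R, 0 < e -> exists N0 : nat, forall N, (N0 <= N)%N ->
    forall i j, normc ((X ^+ N) i j) < e.
Proof.
case: n X => [|n] X hX e e0; first by exists 0%N => N _ [].
have [rs hrs] := closed_field_poly_normal (char_poly X).
rewrite (monicP (char_poly_monic X)) scale1r in hrs.
have [||K [rho [_ rho01 hK]]] := @annihilated_pow_decay _ _ _ X rs 1%:M.
- by move=> l lrs; apply: hX; rewrite eigenvalue_root_char hrs root_prod_XsubC.
- by rewrite -hrs Cayley_Hamilton mul0mx.
have [N0 hN0] := geometric_lt K rho01 e0.
exists N0 => N hN i j; apply: le_lt_trans (hN0 _ hN).
by have := hK N i j; rewrite mulmx1.
Qed.

(** * Resolvent and Cayley transform of a stable matrix *)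

Lemma resolvent_unit (R : realType) n (F : 'M[R]_n) (s : R[i]) :
  stable F -> 0 <= complex.Re s -> s%:M - cplx_mx F \in unitmx.
Proof.
move=> sF s0; rewrite -row_free_unit -kermx_eq0; apply/negPn/negP => /rowV0Pn[v].
move=> /sub_kermxP hv v0; suff /sF : eigenvalue (cplx_mx F) s by rewrite ltNge s0.
apply/eigenvalueP; exists v => //; apply/eqP.
by rewrite eq_sym -subr_eq0 -mul_mx_scalar -mulmxBr hv.
Qed.

(** A point [mu] of the open left half-plane is closer to -1 than to 1, and [l] is the quotient (1 +
    mu) / (1 - mu). *)
Lemma normc_cayley_lt1 (R : realType) (l mu : R[i]) :
  complex.Re mu < 0 -> l * (1 - mu) = 1 + mu -> normc l < 1.
Proof.
move=> mu0 /(congr1 (@normc R)); rewrite normcM => h.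
have lt : normc (1 + mu) < normc (1 - mu).
  case: mu mu0 {h} => a b /= a0; rewrite ltr_sqrt; last first.
    by rewrite ltr_pwDl ?sqr_ge0 // exprn_gt0 // subr_gt0 (lt_trans a0).
  by rewrite !add0r sqrrN ltrD2r; nra.
have p : 0 < normc (1 - mu) := le_lt_trans (normc_ge0 _) lt.
by rewrite -(ltr_pM2r p) h mul1r.
Qed.

Lemma cayley_decay (R : realType) n (F : 'M[R]_n) : stable F ->
  exists X : 'M[R[i]]_n,
    (1%:M - cplx_mx F) *m X = 1%:M + cplx_mx F /\
    forall e : R, 0 < e -> exists N0 : nat, forall N, (N0 <= N)%N ->
      forall i j, normc ((X ^+ N) i j) < e.
Proof.
move=> sF; set D := 1%:M - _; have uD : D \in unitmx by apply: resolvent_unit => //=.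
exists (invmx D *m (1%:M + cplx_mx F)); split; first by rewrite mulKVmx.
apply: pow_decay => l /eigenvalueP[u].
rewrite mulmxA; set w := u *m invmx D => hw u0.
have uE : u = w *m D by rewrite mulmxKV.
have w0 : w != 0 by apply: contraNneq u0 => w0; rewrite uE w0 mul0mx.
move: hw; rewrite uE /D mulmxDr mulmxBr !mulmx1 => hw.
(* This makes [w] a row eigenvector of [F] for (l - 1) / (1 + l), once [1 + l] is known to be
   nonzero. *)
have hl : (1 + l) *: (w *m cplx_mx F) = (l - 1) *: w.
  rewrite scalerDl scalerBl !scale1r; move: hw; rewrite scalerBr => hw.
  by apply: (addrI w); rewrite addrA hw subrK addrC subrK.
(* If 1 + l = 0, then (l - 1) w = 0 forces l = 1, hence 2 = 0. *)
have l1 : 1 + l != 0.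
  apply: contraNneq w0 => l1; move: hl; rewrite l1 scale0r => /esym/eqP.
  rewrite scaler_eq0 => /orP[] // /eqP h; have := l1.
  have -> : 1 + l = (l - 1) + 2 by ring.
  by rewrite h add0r => /eqP; rewrite pnatr_eq0.
apply: (@normc_cayley_lt1 _ _ ((l - 1) / (1 + l))); last by field.
apply: sF; apply/eigenvalueP; exists w => //.
apply: (scalerI l1); rewrite hl scalerA; congr (_ *: _); by field.
Qed.

(** * Lyapunov equations: uniqueness and existence *)

Lemma normc_mulmxl (R : realType) m n k (A : 'M[R[i]]_(m, n))
    (B : 'M[R[i]]_(n, k)) (a : R) i j :
  (forall i k, normc (A i k) <= a) ->
  normc ((A *m B) i j) <= a * \sum_l normc (B l j).
Proof.
move=> hA; rewrite mxE (le_trans (normc_sum _ _)) // mulr_sumr.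
by apply: ler_sum => l _; rewrite normcM ler_wpM2r ?normc_ge0.
Qed.

Lemma normc_mulmxr (R : realType) m n k (A : 'M[R[i]]_(m, n))
    (B : 'M[R[i]]_(n, k)) (b : R) i j :
  (forall k j, normc (B k j) <= b) ->
  normc ((A *m B) i j) <= (\sum_l normc (A i l)) * b.
Proof.
move=> hB; rewrite mxE (le_trans (normc_sum _ _)) // mulr_suml.
by apply: ler_sum => l _; rewrite normcM ler_wpM2l ?normc_ge0.
Qed.

(** The Cayley transform turns the homogeneous equation into the discrete one P' = X^T P' X with P'
    = D^T P D and D = 1 - F. Iterating it gives P' = (X^N)^T P' X^N, which tends to 0. *)
Lemma lyapunov_unique (R : realType) n (F P : 'M[R]_n) :
  stable F -> F^T *m P + P *m F = 0 -> P = 0.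
Proof.
move=> sF hP; have [X [hX dX]] := cayley_decay sF.
set D := 1%:M - _ in hX; have uD : D \in unitmx by apply: resolvent_unit => //=.
have hPc : (cplx_mx F)^T *m cplx_mx P = - (cplx_mx P *m cplx_mx F).
  apply/eqP; rewrite -addr_eq0 /cplx_mx map_trmx -!map_mxM -map_mxD hP.
  by rewrite map_mx0.
set P' := D^T *m cplx_mx P *m D.
have hP' : P' = X^T *m P' *m X.
  rewrite /P' -!mulmxA hX !mulmxA -trmx_mul hX /D.
  have -> : (1%:M - cplx_mx F)^T = 1%:M - (cplx_mx F)^T by rewrite linearB /= trmx1.
  have -> : (1%:M + cplx_mx F)^T = 1%:M + (cplx_mx F)^T by rewrite linearD /= trmx1.
  move: (cplx_mx F) hPc => f hPc.
  rewrite !(mulmxBl, mulmxDl) !mul1mx hPc !mulNmx !(mulmxDr, mulmxBr) !mulmx1.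
  by rewrite !mulmxN opprK opprD addrA subrK addrA addrK.
have hN N : P' = (X ^+ N)^T *m P' *m X ^+ N.
  elim: N => [|N IH]; first by rewrite expr0 trmx1 mulmx1 mul1mx.
  by rewrite {1}hP' {1}IH exprSr trmx_mul !mulmxA.
suff P'0 : P' = 0.
  have : cplx_mx P = 0.
    have := congr1 (fun M => invmx D^T *m M *m invmx D) P'0.
    by rewrite /P' -!mulmxA mulKmx ?unitmx_tr // mulmxV // mulmx1 mul0mx mulmx0.
  move=> /matrixP h; apply/matrixP => i j; have := h i j.
  by rewrite !mxE => -[].
apply/matrixP => i j; rewrite [in RHS]mxE; apply: eq0_normc.
apply/eqP/negPn/negP => p0.
set p := normc _ in p0; have {}p0 : 0 < p by rewrite lt_def p0 normc_ge0.
set S := \sum_k \sum_l normc (P' k l).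
have pS : p <= S.
  rewrite /S (bigD1 i) //= (bigD1 j) //= -addrA lerDl addr_ge0 //.
    by apply: sumr_ge0 => ? _; apply: normc_ge0.
  by apply: sumr_ge0 => ? _; apply: sumr_ge0 => ? _; apply: normc_ge0.
have S0 : 0 < S := lt_le_trans p0 pS.
(* As [p <= S], this choice yields e S = p / 2 and e <= 1 / 2, so e^2 S <= p / 4, against the bound
   [p <= e * e * S] obtained next. *)
set e := p / (2 * S); have e0 : 0 < e by rewrite divr_gt0 // mulr_gt0.
have [N0 /(_ N0 (leqnn _)) hX0] := dX e e0.
have le : p <= e * e * S.
  rewrite /p (hN N0) mulrC mulrA.
  apply: le_trans; first by apply: normc_mulmxr => k l; exact: ltW (hX0 k l).
  rewrite ler_pM2r // /S exchange_big /= mulr_suml.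
  apply: ler_sum => k _; rewrite mulrC.
  by apply: normc_mulmxl => i' k'; rewrite mxE ltW.
have eS : e * S = p / 2 by rewrite /e; field; rewrite gt_eqF.
have e2 : e <= 1 / 2 by rewrite -(ler_pM2r S0) eS; lra.
move: le; rewrite -mulrA eS; nra.
Qed.

(** The Lyapunov operator is an endomorphism of a finite-dimensional space, injective by
    [lyapunov_unique], hence surjective. *)
Lemma lyapunov_exists (R : realType) n (F Q : 'M[R]_n) :
  stable F -> exists P, F^T *m P + P *m F = Q.
Proof.
move=> sF; pose f : {linear 'M[R]_n -> 'M[R]_n} := mulmx F^T \+ mulmxr F.
have u : lin_mx f \in unitmx.
  rewrite -row_free_unit -kermx_eq0; apply/negPn/negP => /rowV0Pn[w].
  move=> /sub_kermxP hw; case/negP; apply/eqP.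
  have : vec_mx w = 0 :> 'M[R]_n.
    apply: (lyapunov_unique sF); rewrite -[LHS]/(f (vec_mx w)).
    by apply: (can_inj mxvecK); rewrite -mul_vec_lin vec_mxK hw linear0.
  by move/(congr1 mxvec); rewrite vec_mxK linear0.
exists (vec_mx (mxvec Q *m invmx (lin_mx f))); rewrite -[LHS]/(f _).
by apply: (can_inj mxvecK); rewrite -mul_vec_lin vec_mxK mulmxKV.
Qed.

(** * Conjugate transpose and the resolvent identity on the imaginary axis *)

Definition ctrmx (R : realType) m n (M : 'M[R[i]]_(m, n)) : 'M[R[i]]_(n, m) :=
  (map_mx Num.conj M)^T.

Lemma ctrmxM (R : realType) m n p (M : 'M[R[i]]_(m, n)) (N : 'M[R[i]]_(n, p)) :
  ctrmx (M *m N) = ctrmx N *m ctrmx M.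
Proof. by rewrite /ctrmx map_mxM trmx_mul. Qed.

Lemma ctrmxB (R : realType) m n (M N : 'M[R[i]]_(m, n)) :
  ctrmx (M - N) = ctrmx M - ctrmx N.
Proof. by rewrite /ctrmx map_mxB linearB. Qed.

Lemma ctrmxZ (R : realType) m n (a : R[i]) (M : 'M[R[i]]_(m, n)) :
  ctrmx (a *: M) = a^* *: ctrmx M.
Proof. by rewrite /ctrmx map_mxZ linearZ. Qed.

Lemma ctrmx_cplx (R : realType) m n (M : 'M[R]_(m, n)) :
  ctrmx (cplx_mx M) = cplx_mx M^T.
Proof.
apply/matrixP => i j; rewrite !mxE.
by apply/CrealP; apply/complex_realP; exists (M j i).
Qed.

(** Substitute F r = s r - u and its adjoint into r^* (F^T P + P F) r: the two terms s r^* P r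
    cancel because [s] is imaginary. *)
Lemma lyapunov_resolvent (R : realType) n (F P Q : 'M[R]_n)
    (s : R[i]) (r u : 'cV[R[i]]_n) :
  s^* = - s -> F^T *m P + P *m F = - Q -> (s%:M - cplx_mx F) *m r = u ->
  ctrmx r *m cplx_mx Q *m r = ctrmx u *m cplx_mx P *m r + ctrmx r *m cplx_mx P *m u.
Proof.
move=> hs hP hr.
have Fr : cplx_mx F *m r = s *: r - u.
  by rewrite -hr mulmxBl mul_scalar_mx opprB addrC subrK.
have rF : ctrmx r *m cplx_mx F^T = - s *: ctrmx r - ctrmx u.
  by rewrite -ctrmx_cplx -ctrmxM Fr ctrmxB ctrmxZ hs.
have -> : cplx_mx Q = - (cplx_mx F^T *m cplx_mx P + cplx_mx P *m cplx_mx F).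
  by rewrite /cplx_mx -!map_mxM -map_mxD hP map_mxN opprK.
rewrite mulmxN mulNmx mulmxDr mulmxDl !mulmxA rF -[_ *m cplx_mx F *m r]mulmxA Fr.
rewrite !mulmxBl mulmxBr -!scalemxAr -!scalemxAl scaleNr.
move: (s *: _) (_ *m r) (_ *m u) => a b c.
by apply/matrixP => i j; rewrite !mxE; ring.
Qed.

(** * Averages of the Cayley resolvent over roots of unity *)

(** In characteristic 0 the polynomial X^N - 1 is separable, so it has N distinct roots, enough for
    one of them to be primitive. *)
Lemma prim_root_exists (R : realType) N :
  (0 < N)%N -> exists z : R[i], N.-primitive_root z.
Proof.
pose p : {poly R[i]} := 'X^N - 1; have [rs Dp] := closed_field_poly_normal p.
move=> N0; rewrite (monicP _) ?monicXnsubC // scale1r in Dp.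
have rs1 : all N.-unity_root rs by apply/allP => z; rewrite -root_prod_XsubC -Dp.
have szr : (N < (size rs).+1)%N.
  by rewrite -(size_prod_XsubC rs id) -Dp size_XnsubC.
have [|z _ hz] := hasP (has_prim_root N0 rs1 _ szr); last by exists z.
by rewrite -separable_prod_XsubC -Dp separable_Xn_sub_1 // pnatr_eq0 -lt0n.
Qed.

(** For [k] nonzero this is a geometric sum whose ratio differs from 1 but has N-th power 1. *)
Lemma sum_prim_root_expr (R : realType) N (z : R[i]) k :
  N.-primitive_root z -> (k < N)%N ->
  \sum_(m < N) ((z ^+ m)^-1) ^+ k = (N * (k == 0%N))%:R.
Proof.
move=> hz kN; case: eqVneq => [->|k0].
  by under eq_bigr do rewrite expr0; rewrite sumr_const card_ord muln1.
rewrite muln0; set y := (z ^+ k)^-1.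
have -> : \sum_(m < N) ((z ^+ m)^-1) ^+ k = \sum_(m < N) y ^+ m.
  by apply: eq_bigr => m _; rewrite /y !exprVn -!exprM mulnC.
have y1 : y != 1.
  rewrite invr_eq1 -(prim_order_dvd hz).
  by apply/negP => /dvdn_leq; rewrite lt0n k0 leqNgt kN => /(_ isT).
have : (y - 1) * (\sum_(m < N) y ^+ m) = 0.
  by rewrite -subrX1 /y exprVn exprAC (prim_expr_order hz) expr1n invr1 subrr.
by move/eqP; rewrite mulf_eq0 subr_eq0 (negbTE y1) /= => /eqP.
Qed.

(* Averaging the Neumann series of the resolvent over the N-th roots of unity
   kills all the powers of X below X ^+ N but the first one. *)
Lemma sum_root_resolvent (R : realType) n (X : 'M[R[i]]_n) N (z : R[i])
    (v : 'cV[R[i]]_n) (t : 'I_N -> 'cV[R[i]]_n) :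
  N.-primitive_root z ->
  (forall m, t m = v + (z ^+ m)^-1 *: (X *m t m)) ->
  \sum_m t m = N%:R *: v + X ^+ N *m \sum_m t m.
Proof.
move=> hz ht.
have tE m k : t m = \sum_(l < k) ((z ^+ m)^-1) ^+ l *: (X ^+ l *m v) +
    ((z ^+ m)^-1) ^+ k *: (X ^+ k *m t m).
  elim: k => [|k IH]; first by rewrite big_ord0 add0r !expr0 scale1r mul1mx.
  rewrite {1}IH big_ord_recr /= -addrA; congr (_ + _).
  rewrite {1}ht mulmxDr scalerDr; congr (_ + _).
  by rewrite -scalemxAr scalerA mulmxA -[X ^+ k *m X]/(X ^+ k * X) -!exprSr.
have zN m : ((z ^+ m)^-1) ^+ N = 1.
  by rewrite exprVn exprAC (prim_expr_order hz) expr1n invr1.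
transitivity (\sum_(m < N) (\sum_(l < N) ((z ^+ m)^-1) ^+ l *: (X ^+ l *m v) +
    X ^+ N *m t m)).
  by apply: eq_bigr => m _; rewrite {1}(tE m N) zN scale1r.
rewrite big_split /= -mulmx_sumr; congr (_ + _).
rewrite exchange_big /=.
under eq_bigr => l _ do rewrite -scaler_suml (sum_prim_root_expr hz (ltn_ord l)).
have N0 := prim_order_gt0 hz; case: N N0 {t ht tE zN hz} => // N _.
rewrite big_ord_recl big1 => [|l _]; last by rewrite muln0 scale0r.
by rewrite muln1 expr0 mul1mx addr0.
Qed.

(** Quantitative form of (1 - Y)^-1 being close to 1, without forming the inverse. The l1 norm [W]
    of [T] satisfies W <= S + n e W <= S + W / 2, so W <= 2 S, and T - v = Y T is of order [e]. *)
Lemma near_fixpoint (R : realType) n (Y : 'M[R[i]]_n) (v T : 'cV[R[i]]_n) (e : R) :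
  (forall i j, normc (Y i j) <= e) -> n%:R * e <= 1 / 2 -> 0 <= e ->
  T = v + Y *m T -> forall i, normc ((T - v) i 0) <= e * (2 * \sum_j normc (v j 0)).
Proof.
move=> hY ne e0 hT.
set S := \sum_j _; pose W := \sum_j normc (T j 0).
have YT i : normc ((Y *m T) i 0) <= e * W by apply: normc_mulmxl.
have W0 : 0 <= W by apply: sumr_ge0 => ? _; apply: normc_ge0.
have hW : W <= S + n%:R * (e * W).
  have -> : n%:R * (e * W) = \sum_(j < n) (e * W).
    by rewrite sumr_const card_ord mulr_natl.
  rewrite /W {1}hT /S -big_split /=; apply: ler_sum => j _.
  by rewrite mxE (le_trans (le_normcD _ _)) // lerD2l.
have W2 : W <= 2 * S by nra.
move=> i; have -> : T - v = Y *m T by rewrite {1}hT addrC addKr.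
by apply: le_trans (YT i) _; rewrite ler_wpM2l.
Qed.

Lemma conj_unity_root (R : realType) N (z : R[i]) :
  (0 < N)%N -> z ^+ N = 1 -> z^* = z^-1.
Proof.
move=> N0 zN; have z1 : `|z| = 1.
  by apply/eqP; rewrite -(@pexpr_eq1 _ _ N) // -normrX zN normr1.
have z0 : z != 0 by rewrite -normr_eq0 z1 oner_eq0.
by apply: (mulfI z0); rewrite -normCK z1 expr1n divff.
Qed.

(** The Cayley map sends the unit circle, minus the point -1, to the imaginary axis. *)
Lemma cayley_imaginary (R : realType) (z : R[i]) : z + 1 != 0 -> z != 0 ->
  z^* = z^-1 -> let s := (z - 1) / (z + 1) in s^* = - s.
Proof.
move=> z1 z0 zc /=; rewrite fmorph_div rmorphB rmorphD rmorph1 /= zc; field.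
by rewrite z1 z0.
Qed.

Lemma conjN_imaginary (R : realType) (s : R[i]) : s^* = - s -> exists w, s = Complex 0 w.
Proof.
case: s => a b /(congr1 (@complex.Re R)) /= h; exists b; congr Complex; lra.
Qed.

(* [t] is [z (z - X)^-1 v] for the Cayley transform X of F. *)
Lemma cayley_resolvent (R : realType) n (f X : 'M[R[i]]_n)
    (z : R[i]) (v r : 'cV[R[i]]_n) :
  z != 0 -> z + 1 != 0 -> 1%:M - f \in unitmx -> (1%:M - f) *m X = 1%:M + f ->
  let s := (z - 1) / (z + 1) in (s%:M - f) *m r = v ->
  let t := 2^-1 *: ((1 - s ^+ 2) *: r + (1 + s) *: v) in
  t = v + z^-1 *: (X *m t).
Proof.
move=> z0 z1 uD hX s hr t; have fr : f *m r = s *: r - v.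
  by rewrite -hr mulmxBl mul_scalar_mx opprB addrC subrK.
have ft : f *m t = 2^-1 *: ((1 - s ^+ 2) *: (s *: r - v) + (1 + s) *: (f *m v)).
  by rewrite -scalemxAr mulmxDr -!scalemxAr fr.
rewrite -[LHS](mulKmx uD) -[RHS](mulKmx uD); congr (_ *m _).
have tE : t = 2^-1 *: ((1 - s ^+ 2) *: r + (1 + s) *: v) by [].
clearbody t; rewrite mulmxDr -scalemxAr mulmxA hX !mulmxBl mulmxDl !mul1mx ft tE.
move: (f *m v) => fv; apply/matrixP => i j; rewrite !mxE /s; field.
by rewrite z1 z0.
Qed.

(** * From nonnegativity at all frequencies to nonnegative energy *)

(** The averaged identity is kept exact for each odd [N]: with [T] the average of the vectors [t m],
    the deviation from v^T P v is linear in T - v, and the limit is left to [frequency_nonneg]. *)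
Lemma frequency_average (R : realType) n (F P Q : 'M[R]_n) (v : 'cV[R]_n)
    (X : 'M[R[i]]_n) N :
  stable F -> F^T *m P + P *m F = - Q ->
  (1%:M - cplx_mx F) *m X = 1%:M + cplx_mx F -> odd N ->
  (forall w (r : 'cV[R[i]]_n), ((Complex 0 w)%:M - cplx_mx F) *m r = cplx_mx v ->
    0 <= (ctrmx r *m cplx_mx Q *m r) 0 0) ->
  exists2 T, T = cplx_mx v + X ^+ N *m T &
    0 <= (ctrmx (cplx_mx v) *m cplx_mx P *m cplx_mx v +
          ctrmx (cplx_mx v) *m cplx_mx P *m (T - cplx_mx v) +
          ctrmx (T - cplx_mx v) *m (cplx_mx P *m cplx_mx v)) 0 0.
Proof.
move=> sF hP hX oN hQ; have N0 : (0 < N)%N by case: N oN.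
have [z hz] := prim_root_exists R N0.
have uD : 1%:M - cplx_mx F \in unitmx by apply: resolvent_unit => //=.
set V := cplx_mx v; pose x m := z ^+ m; pose s m := (x m - 1) / (x m + 1).
have xN m : x m ^+ N = 1 by rewrite /x exprAC (prim_expr_order hz) expr1n.
have x0 m : x m != 0.
  by apply: contra_eq_neq (xN m) => ->; rewrite expr0n gtn_eqF // eq_sym oner_eq0.
(* Here [N] odd matters: (-1)^N = -1, so -1 is not an N-th root of unity and [s m] has no pole. *)
have x1 m : x m + 1 != 0.
  apply: contra_eq_neq (xN m) => /eqP; rewrite addr_eq0 => /eqP ->.
  by rewrite -signr_odd oN expr1 eq_sym -subr_eq0 opprK -(natrD _ 1 1) pnatr_eq0.
have sc m : (s m)^* = - s m by apply: cayley_imaginary (conj_unity_root N0 (xN m)).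
pose r m := invmx ((s m)%:M - cplx_mx F) *m V.
have hr m : ((s m)%:M - cplx_mx F) *m r m = V.
  have [w sw] := conjN_imaginary (sc m).
  by rewrite mulKVmx //; apply: resolvent_unit => //; rewrite sw.
pose a m := 1 - s m ^+ 2.
pose t m := 2^-1 *: (a m *: r m + (1 + s m) *: V).
have ht m : t m = V + (x m)^-1 *: (X *m t m)
  by exact: (cayley_resolvent (x0 m) (x1 m) uD hX (hr m)).
have hT := sum_root_resolvent hz (fun m : 'I_N => ht m).
set T' := \sum_(m < N) t m in hT.
have Nn0 : N%:R != 0 :> R[i] by rewrite pnatr_eq0 -lt0n.
exists (N%:R^-1 *: T').
  by rewrite {1}hT scalerDr scalerA mulVf // scale1r -scalemxAr.
set T := _ *: T'.
(* For [s m] imaginary, 1 - s^2 = (1 - s)(1 + s) is a squared modulus, hence a nonnegative real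
   weight. *)
have aE m : a m = `|1 - s m| ^+ 2.
  by rewrite normCK rmorphB rmorph1 /= sc opprK /a; ring.
have ar m : a m *: r m = 2 *: t m - (1 + s m) *: V.
  by rewrite /t scalerA mulfV ?pnatr_eq0 // scale1r addrK.
set B := ctrmx V *m _ *m _; set C := ctrmx V *m _ *m _; set D := ctrmx _ *m _.
have key : \sum_(m < N) a m *: (ctrmx (r m) *m cplx_mx Q *m r m) =
    (2 * N%:R) *: (B + C + D).
  pose Y := \sum_(m < N) a m *: r m; pose sg := \sum_(m < N) (1 + s m).
  have YE : Y = (2 * N%:R) *: T - sg *: V.
    rewrite /Y /T /sg scaler_suml scalerA mulrK ?unitfE // /T' scaler_sumr -sumrB.
    by apply: eq_bigr => m _.
  (* Each 1 + s m has real part 1, so [sg] has real part [N]; in [key] the terms in [sg] thus add up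
     to -2 N v^T P v. *)
  have sgE : sg^* = 2 * N%:R - sg.
    rewrite /sg -[N in 2 * N%:R]card_ord -sumr_const mulr_sumr -sumrB rmorph_sum /=.
    by apply: eq_bigr => m _; rewrite rmorphD rmorph1 /= sc; ring.
  have ca m : (a m)^* = a m by rewrite aE rmorphXn /= conj_normC.
  transitivity (ctrmx V *m cplx_mx P *m Y + ctrmx Y *m cplx_mx P *m V).
    rewrite mulmx_sumr.
    have -> : ctrmx Y = \sum_(m < N) a m *: ctrmx (r m).
      rewrite /Y /ctrmx map_mx_sum linear_sum /=; apply: eq_bigr => m _.
      by rewrite map_mxZ linearZ /= ca.
    rewrite !mulmx_suml -big_split /=; apply: eq_bigr => m _.
    rewrite (lyapunov_resolvent (sc m) hP (hr m)) -/V scalerDr.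
    by rewrite -!scalemxAr -!scalemxAl.
  clearbody T; rewrite YE ctrmxB !ctrmxZ sgE rmorphM /= !conjC_nat /B /C /D ctrmxB.
  rewrite !(mulmxBl, mulmxBr) -!mulmxA -!scalemxAr -!scalemxAl.
  move: (ctrmx V *m (_ *m V)) (ctrmx V *m (_ *m T)) (ctrmx T *m _) => b c d.
  by apply/matrixP => i j; rewrite !mxE; ring.
have N2 : 0 < 2 * N%:R :> R[i] by rewrite mulr_gt0 ?ltr0n.
rewrite -(pmulr_rge0 _ N2).
have -> : 2 * N%:R * (B + C + D) 0 0 = ((2 * N%:R) *: (B + C + D)) 0 0.
  by rewrite [RHS]mxE.
rewrite -key summxE; apply: sumr_ge0 => m _; rewrite mxE mulr_ge0 //.
  by rewrite aE exprn_ge0.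
have [w sw] := conjN_imaginary (sc m).
by apply: (hQ w); rewrite -sw.
Qed.

Lemma Re_le_normc (R : realType) (z : R[i]) : complex.Re z <= normc z.
Proof.
apply: le_trans (ler_norm _) _; rewrite -lecR -normc_norm; exact: normc_ge_Re.
Qed.

(** If v^T P v were negative, a large odd [N] would make the two error terms of [frequency_average]
    too small to compensate it. *)
Lemma frequency_nonneg (R : realType) n (F P Q : 'M[R]_n) (v : 'cV[R]_n) :
  stable F -> F^T *m P + P *m F = - Q ->
  (forall w (r : 'cV[R[i]]_n), ((Complex 0 w)%:M - cplx_mx F) *m r = cplx_mx v ->
    0 <= (ctrmx r *m cplx_mx Q *m r) 0 0) ->
  0 <= (v^T *m P *m v) 0 0.
Proof.
move=> sF hP hQ; have [X [hX dX]] := cayley_decay sF.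
set c : R := (_ *m v) 0 0; rewrite leNgt; apply/negP => c0.
set V := cplx_mx v.
pose S := \sum_j normc (V j 0).
pose K := \sum_j normc ((ctrmx V *m cplx_mx P) 0 j) + \sum_j normc ((cplx_mx P *m V) j 0).
have S0 : 0 <= S by apply: sumr_ge0 => ? _; apply: normc_ge0.
have K0 : 0 <= K by rewrite addr_ge0 //; apply: sumr_ge0 => ? _; apply: normc_ge0.
(* The error terms total at most 2 d S K = d M - d, strictly below d M <= -c. The first bound in [d]
   serves [near_fixpoint], with [n.+1] so that the denominator stays nonzero for n = 0. *)
pose M := 2 * S * K + 1; have M0 : 0 < M by rewrite ltr_wpDl // !mulr_ge0.
pose d := Num.min (1 / (2 * n.+1%:R)) (- c / M).
have d0 : 0 < d by rewrite lt_min !divr_gt0 ?mulr_gt0 ?ltr0n // oppr_gt0.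
have nd : n%:R * d <= 1 / 2.
  have : n.+1%:R * d <= n.+1%:R * (1 / (2 * n.+1%:R)).
    by rewrite ler_wpM2l // ge_min lexx.
  have -> : n.+1%:R * (1 / (2 * n.+1%:R)) = 1 / 2 :> R.
    have : n.+1%:R != 0 :> R by rewrite pnatr_eq0.
    by move: n.+1%:R => k k0; field.
  by apply: le_trans; rewrite ler_wpM2r ?ler_nat // ltW.
have dM : d * M <= - c by rewrite -ler_pdivlMr // ge_min lexx orbT.
have [N0 hN0] := dX d d0.
have oN : odd (N0.*2.+1) by rewrite /= odd_double.
have [T hT] := frequency_average sF hP hX oN hQ; rewrite -/V.
have hd i : normc ((T - V) i 0) <= d * (2 * S).
  apply: (near_fixpoint _ nd (ltW d0) hT) => k l; apply/ltW/hN0.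
  by rewrite (leq_trans _ (leqnSn _)) // -addnn leq_addr.
have d2 : 0 <= d * (2 * S) by rewrite !mulr_ge0 // ltW.
have cE : (ctrmx V *m cplx_mx P *m V) 0 0 = c%:C%C.
  by rewrite ctrmx_cplx /cplx_mx -!map_mxM mxE.
rewrite 2!mxE cE; set x : R[i] := (_ *m (T - V)) 0 0; set y : R[i] := (_ *m (_ *m V)) 0 0.
have hx : normc x <= (\sum_j normc ((ctrmx V *m cplx_mx P) 0 j)) * (d * (2 * S)).
  by apply: normc_mulmxr => k j; rewrite ord1.
have hy : normc y <= (d * (2 * S)) * \sum_j normc ((cplx_mx P *m V) j 0).
  apply: normc_mulmxl => i j; rewrite ord1 /ctrmx 2!mxE.
  suff -> : normc (((T - V) j 0)^*) = normc ((T - V) j 0) by [].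
  by case: (_ j 0) => p q /=; rewrite sqrrN.
move=> h; have : - c <= normc (x + y).
  apply: le_trans (Re_le_normc _); move: h; rewrite -addrA.
  by case: (x + y) => p q /andP[_] /=; clear; lra.
have := le_normcD x y; have : d * (2 * S) * K <= d * M - d.
  by rewrite le_eqVlt; apply/orP; left; apply/eqP; rewrite /M; ring.
rewrite /K mulrDr [X in X + _]mulrC; move: hx hy dM d0.
by clear; lra.
Qed.

(** * Euclidean, operator and H-infinity norms *)

Lemma cenorm_ge0 (R : realType) n (z : 'cV[R[i]]_n) : 0 <= cenorm z.
Proof. exact: sqrtr_ge0. Qed.

Lemma cenorm_sqr (R : realType) n (z : 'cV[R[i]]_n) :
  cenorm z ^+ 2 = \sum_i normc (z i 0) ^+ 2.
Proof. by rewrite sqr_sqrtr // sumr_ge0 // => i _; rewrite sqr_ge0. Qed.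

Lemma cenorm_ctrmx (R : realType) n (z : 'cV[R[i]]_n) :
  (ctrmx z *m z) 0 0 = (cenorm z ^+ 2)%:C%C.
Proof.
rewrite cenorm_sqr rmorph_sum mxE; apply: eq_bigr => i _.
by rewrite rmorphXn /= -normc_norm normCK mulrC /ctrmx !mxE.
Qed.

Lemma normc_le_cenorm (R : realType) n (z : 'cV[R[i]]_n) i : normc (z i 0) <= cenorm z.
Proof.
rewrite -(ler_pXn2r (ltn0Sn 1)) ?nnegrE ?normc_ge0 ?cenorm_ge0 //.
by rewrite cenorm_sqr (bigD1 i) //= lerDl sumr_ge0 // => j _; rewrite sqr_ge0.
Qed.

Lemma cenorm_le_sum (R : realType) n (z : 'cV[R[i]]_n) :
  cenorm z <= \sum_i normc (z i 0).
Proof.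
have s0 (s : seq 'I_n) : 0 <= \sum_(i <- s) normc (z i 0).
  by apply: sumr_ge0 => i _; exact: normc_ge0.
rewrite -(ler_pXn2r (ltn0Sn 1)) ?nnegrE ?cenorm_ge0 // ?s0 // cenorm_sqr.
elim: (index_enum _) => [|i s IH]; first by rewrite !big_nil expr0n.
rewrite !big_cons sqrrD -addrA lerD2l (le_trans IH) // lerDr.
by rewrite mulrn_wge0 // mulr_ge0 ?normc_ge0.
Qed.

Lemma cenormZ (R : realType) n (a : R[i]) (z : 'cV[R[i]]_n) :
  cenorm (a *: z) = normc a * cenorm z.
Proof.
apply/eqP; rewrite -(@eqrXn2 _ 2) ?mulr_ge0 ?cenorm_ge0 ?normc_ge0 // exprMn !cenorm_sqr.
by rewrite mulr_sumr; apply/eqP/eq_bigr => i _; rewrite mxE normcM exprMn.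
Qed.

Lemma cenorm0 (R : realType) n : cenorm (0 : 'cV[R[i]]_n) = 0.
Proof.
apply/le_anti; rewrite cenorm_ge0 andbT (le_trans (cenorm_le_sum _)) //.
by rewrite big1 // => i _; rewrite mxE normc0.
Qed.

Lemma cenorm0_eq0 (R : realType) n (z : 'cV[R[i]]_n) : cenorm z = 0 -> z = 0.
Proof.
move=> z0; apply/matrixP => i j; rewrite ord1 mxE; apply: eq0_normc.
by apply/le_anti; rewrite normc_ge0 andbT -z0 normc_le_cenorm.
Qed.

Lemma cenorm_mulmx (R : realType) m n (M : 'M[R[i]]_(m, n)) (z : 'cV[R[i]]_n) :
  cenorm (M *m z) <= (\sum_i \sum_j normc (M i j)) * cenorm z.
Proof.
apply: le_trans (cenorm_le_sum _) _; rewrite mulr_suml; apply: ler_sum => i _.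
by apply: normc_mulmxr => k j; rewrite ord1 normc_le_cenorm.
Qed.

(** The crude factor [n] is harmless: the bound only certifies that the H-infinity norm of G1 + I is
    finite. *)
Lemma cenormD_le (R : realType) n (y z : 'cV[R[i]]_n) :
  cenorm (y + z) <= n%:R * (cenorm y + cenorm z).
Proof.
apply: le_trans (cenorm_le_sum _) _.
have -> : n%:R * (cenorm y + cenorm z) = \sum_(i < n) (cenorm y + cenorm z).
  by rewrite sumr_const card_ord mulr_natl.
apply: ler_sum => i _.
by rewrite mxE (le_trans (le_normcD _ _)) // lerD ?normc_le_cenorm.
Qed.

(** Guarantees that the real [sup] in [opnorm] is a genuine supremum and not its default value. *)
Lemma opnorm_has_sup (R : realType) m n (M : 'M[R[i]]_(m, n)) :
  has_sup [set cenorm (M *m z) | z in [set z : 'cV[R[i]]_n | cenorm z <= 1]].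
Proof.
split.
  by exists (cenorm (M *m 0)); exists 0 => //=; rewrite cenorm0.
exists (\sum_i \sum_j normc (M i j)) => _ [z /= z1 <-].
apply: le_trans (cenorm_mulmx _ _) _; rewrite -[leRHS]mulr1 ler_wpM2l //.
by apply: sumr_ge0 => i _; apply: sumr_ge0 => j _; exact: normc_ge0.
Qed.

Lemma cenorm_opnorm (R : realType) m n (M : 'M[R[i]]_(m, n)) (z : 'cV[R[i]]_n) :
  cenorm (M *m z) <= opnorm M * cenorm z.
Proof.
have [z00|z0] := eqVneq (cenorm z) 0.
  by rewrite z00 mulr0 (cenorm0_eq0 z00) mulmx0 cenorm0.
have zp : 0 < cenorm z by rewrite lt_def z0 cenorm_ge0.
have nz : normc ((cenorm z)^-1)%:C%C = (cenorm z)^-1.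
  by rewrite /= expr0n addr0 sqrtr_sqr ger0_norm // invr_ge0 ltW.
rewrite -ler_pdivrMr // mulrC -{1}nz -cenormZ scalemxAr.
apply: ub_le_sup; first by case: (opnorm_has_sup M).
by exists (((cenorm z)^-1)%:C%C *: z) => //=; rewrite cenormZ nz mulVf.
Qed.

Lemma opnorm_le (R : realType) m n (M : 'M[R[i]]_(m, n)) (K : R) : 0 <= K ->
  (forall z, cenorm (M *m z) <= K * cenorm z) -> opnorm M <= K.
Proof.
move=> K0 hM; apply: ge_sup; first by case: (opnorm_has_sup M).
by move=> _ [z /= z1 <-]; rewrite (le_trans (hM z)) // -[leRHS]mulr1 ler_wpM2l.
Qed.

Lemma opnorm_ge0 (R : realType) m n (M : 'M[R[i]]_(m, n)) : 0 <= opnorm M.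
Proof.
case: (opnorm_has_sup M) => -[_ [z z1 _]] ub.
by apply: le_trans (cenorm_ge0 (M *m z)) _; apply: ub_le_sup => //; exists z.
Qed.

Lemma Hinf_norm_fin (R : realType) m n (G : R[i] -> 'M[R[i]]_(m, n)) (K : R) :
  (forall w, opnorm (G (Complex 0 w)) <= K) ->
  Hinf_norm G \is a fin_num /\ forall w, opnorm (G (Complex 0 w)) <= fine (Hinf_norm G).
Proof.
move=> hK; have lb w : ((opnorm (G (Complex 0 w)))%:E <= Hinf_norm G)%E.
  by apply: ereal_sup_ubound; exists w.
have ub : (Hinf_norm G <= K%:E)%E.
  by apply: ge_ereal_sup => _ [w _ <-]; rewrite lee_fin.
(* The value at frequency 0 excludes minus infinity, the uniform bound excludes plus infinity. *)
have f : Hinf_norm G \is a fin_num.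
  by rewrite fin_numElt (lt_le_trans (ltNyr _) (lb 0)) (le_lt_trans ub (ltry _)).
by split=> // w; rewrite -lee_fin fineK.
Qed.

(* Pairing the equation with the solution of the Lyapunov equation for Q = 1
   bounds the resolvent uniformly along the imaginary axis. *)
Lemma resolvent_bounded (R : realType) n (F : 'M[R]_n) : stable F ->
  exists2 K : R, 0 <= K & forall w (r u : 'cV[R[i]]_n),
    ((Complex 0 w)%:M - cplx_mx F) *m r = u -> cenorm r <= K * cenorm u.
Proof.
move=> sF; have [P hP] := lyapunov_exists (- 1%:M) sF.
set cP := cplx_mx P.
pose S1 := \sum_j \sum_l normc (cP l j); pose S2 := \sum_l \sum_k normc (cP l k).
have S10 : 0 <= S1 by apply: sumr_ge0 => i _; apply: sumr_ge0 => j _; exact: normc_ge0.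
have S20 : 0 <= S2 by apply: sumr_ge0 => i _; apply: sumr_ge0 => j _; exact: normc_ge0.
exists (S1 + S2); first by rewrite addr_ge0.
move=> w r u hr.
have sc : (Complex 0 w)^* = - Complex 0 w :> R[i].
  by apply/eqP; rewrite eq_complex /= oppr0 !eqxx.
have := congr1 (fun M : 'M[R[i]]_1 => normc (M 0 0)) (lyapunov_resolvent sc hP hr).
have -> : cplx_mx 1%:M = 1%:M :> 'M[R[i]]_n by rewrite /cplx_mx map_mx1.
rewrite mulmx1 cenorm_ctrmx mxE.
have -> : normc (cenorm r ^+ 2)%:C%C = cenorm r ^+ 2.
  by rewrite /= expr0n addr0 sqrtr_sqr ger0_norm // sqr_ge0.
move=> E; have := le_normcD ((ctrmx u *m cP *m r) 0 0) ((ctrmx r *m cP *m u) 0 0).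
rewrite -E => {}E.
have hc (z : 'cV[R[i]]_n) i k : normc (ctrmx z i k) <= cenorm z.
  rewrite /ctrmx 2!mxE ord1.
  suff -> : normc ((z k 0)^*) = normc (z k 0) by exact: normc_le_cenorm.
  by case: (z k 0) => p q /=; rewrite sqrrN.
have h1 : normc ((ctrmx u *m cP *m r) 0 0) <= cenorm u * S1 * cenorm r.
  apply: le_trans.
    by apply: normc_mulmxr => k j; rewrite ord1; exact: normc_le_cenorm.
  rewrite ler_wpM2r ?cenorm_ge0 // mulr_sumr.
  by apply: ler_sum => j _; apply: normc_mulmxl => i k; exact: hc.
have h2 : normc ((ctrmx r *m cP *m u) 0 0) <= cenorm r * (S2 * cenorm u).
  rewrite -mulmxA; apply: le_trans; first by apply: normc_mulmxl => i k; exact: hc.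
  rewrite ler_wpM2l ?cenorm_ge0 // mulr_suml; apply: ler_sum => l _.
  by apply: normc_mulmxr => k j; rewrite ord1 normc_le_cenorm.
have [r0|r0] := eqVneq (cenorm r) 0.
  by rewrite r0 mulr_ge0 ?cenorm_ge0 // addr_ge0.
have rp : 0 < cenorm r by rewrite lt_def r0 cenorm_ge0.
rewrite -(ler_pM2r rp) -expr2 (le_trans E) // (le_trans (lerD h1 h2)) //.
by rewrite le_eqVlt; apply/orP; left; apply/eqP; ring.
Qed.

(** * Differentiation on the closed half-line *)

(** Scalar counterpart of [solves]: one-sided continuity at 0 lets monotonicity and the fundamental
    theorem of calculus start from the initial value. *)
Definition C1_on (R : realType) (f df : R -> R) : Prop :=
  {within `[0, +oo[, continuous f} /\ (forall t : R, 0 < t -> is_derive t 1 f (df t)).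

Lemma C1_on_ext (R : realType) (f df g dg : R -> R) :
  f =1 g -> df =1 dg -> C1_on f df -> C1_on g dg.
Proof. by move=> /funext <- /funext <-. Qed.

Lemma C1_on_cst (R : realType) (a : R) : C1_on (fun=> a) (fun=> 0).
Proof.
split; first by move=> x; apply: cvg_cst.
by move=> t _; apply: is_derive_cst.
Qed.

Lemma C1_on_id (R : realType) : C1_on (fun t : R => t) (fun=> 1).
Proof.
split; first by apply: continuous_subspaceT => x; apply: cvg_id.
by move=> t _; apply: is_derive_id.
Qed.

Lemma C1_on_add (R : realType) (f df g dg : R -> R) :
  C1_on f df -> C1_on g dg -> C1_on (fun t => f t + g t) (fun t => df t + dg t).
Proof.
move=> [cf hf] [cg hg]; split; first by move=> x; apply: cvgD; [exact: cf|exact: cg].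
by move=> t t0; apply: is_deriveD; [exact: hf|exact: hg].
Qed.

Lemma C1_on_mul (R : realType) (f df g dg : R -> R) :
  C1_on f df -> C1_on g dg ->
  C1_on (fun t => f t * g t) (fun t => df t * g t + f t * dg t).
Proof.
move=> [cf hf] [cg hg]; split; first by move=> x; apply: cvgM; [exact: cf|exact: cg].
move=> t t0; rewrite addrC [df t * _]mulrC.
by apply: is_deriveM; [exact: hf|exact: hg].
Qed.

Lemma C1_on_sum (R : realType) (I : Type) (s : seq I) (f df : I -> R -> R) :
  (forall i, C1_on (f i) (df i)) ->
  C1_on (fun t => \sum_(i <- s) f i t) (fun t => \sum_(i <- s) df i t).
Proof.
move=> h; elim: s => [|i s IH].
  by apply: C1_on_ext (C1_on_cst 0) => t; rewrite big_nil.
by apply: C1_on_ext (C1_on_add (h i) IH) => t; rewrite big_cons.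
Qed.

Lemma C1_on_nonincreasing (R : realType) (f df : R -> R) :
  C1_on f df -> (forall t, 0 < t -> df t <= 0) -> forall t, 0 <= t -> f t <= f 0.
Proof.
move=> [cf hf] df0 t t0; apply: (@ler0_derive1_nincry _ f 0) => // x.
  by rewrite in_itv /= andbT => x0; have := hf x x0; case.
rewrite in_itv /= andbT => x0; rewrite derive1E.
by have h := hf x x0; rewrite (@derive_val _ _ _ _ _ _ _ h) df0.
Qed.

Lemma solves_coord (R : realType) n (x v : R -> 'cV[R]_n) i :
  solves x v -> C1_on (fun t => x t i 0) (fun t => v t i 0).
Proof.
move=> [cx hx]; split.
  move=> t; apply: (@cvg_comp _ _ _ x (fun M : 'cV[R]_n => M i 0) _ _ _ (cx t)).
  exact: coord_continuous.
move=> t t0; have h := hx t t0; apply: DeriveDef.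
  by move/derivable_mxP: (@ex_derive _ _ _ _ _ _ _ h); apply.
have := @derive_mx _ _ _ _ _ _ _ (@ex_derive _ _ _ _ _ _ _ h).
by rewrite (@derive_val _ _ _ _ _ _ _ h) => ->; rewrite mxE.
Qed.

Lemma C1_on_quad (R : realType) n (F P : 'M[R]_n) (w : R -> 'cV[R]_n) :
  (forall i, C1_on (fun t => w t i 0) (fun t => (F *m w t) i 0)) ->
  C1_on (fun t => ((w t)^T *m P *m w t) 0 0)
        (fun t => ((w t)^T *m (F^T *m P + P *m F) *m w t) 0 0).
Proof.
move=> h.
apply: C1_on_ext (C1_on_sum (index_enum 'I_n) (fun i => C1_on_mul (h i)
  (C1_on_sum (index_enum 'I_n) (fun j => C1_on_mul (C1_on_cst (P i j)) (h j))))) => t.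
  by rewrite -mulmxA mxE; apply: eq_bigr => i _; rewrite !mxE.
rewrite mulmxDr mulmxDl !mulmxA -trmx_mul -mulmxA -[X in _ + X]mulmxA.
rewrite -[_ *m P *m (_ *m _)]mulmxA.
rewrite big_split /= [RHS]mxE; congr (_ + _); rewrite mxE; apply: eq_bigr => i _.
  by rewrite [in RHS]mxE; congr (_ * _); rewrite mxE.
rewrite [in RHS]mxE; congr (_ * _); rewrite mxE.
by apply: eq_bigr => j _; rewrite mul0r add0r.
Qed.

(** * Energy of linear trajectories and the L2 gain *)

Lemma enorm_sqr (R : realType) n (x : 'cV[R]_n) : enorm x ^+ 2 = (x^T *m x) 0 0.
Proof.
rewrite sqr_sqrtr; last by apply: sumr_ge0 => i _; exact: sqr_ge0.
by rewrite mxE; apply: eq_bigr => i _; rewrite mxE expr2.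
Qed.

Lemma quad_le_enorm (R : realType) n (P : 'M[R]_n) (x : 'cV[R]_n) :
  (x^T *m P *m x) 0 0 <= (\sum_i \sum_j `|P i j|) * enorm x ^+ 2.
Proof.
have xi i : `|x i 0| <= enorm x.
  rewrite -(ler_pXn2r (ltn0Sn 1)) ?nnegrE ?normr_ge0 ?sqrtr_ge0 //.
  rewrite real_normK ?num_real // sqr_sqrtr; last first.
    by apply: sumr_ge0 => j _; exact: sqr_ge0.
  by rewrite (bigD1 i) //= lerDl sumr_ge0 // => j _; exact: sqr_ge0.
rewrite -mulmxA mxE mulr_suml; apply: ler_sum => i _.
rewrite !mxE mulr_suml mulr_sumr; apply: ler_sum => j _.
apply: le_trans (ler_norm _) _; rewrite !normrM mulrCA ler_wpM2l //.
by rewrite expr2 ler_pM.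
Qed.

(** [P] is the observability Gramian; at each frequency the form of Q = H^T H is the square of the
    norm of H r. *)
Lemma observability_ge0 (R : realType) n k (F P : 'M[R]_n) (H : 'M[R]_(k, n))
    (v : 'cV[R]_n) :
  stable F -> F^T *m P + P *m F = - (H^T *m H) -> 0 <= (v^T *m P *m v) 0 0.
Proof.
move=> sF hP; apply: frequency_nonneg sF hP _ => w r _.
rewrite {1}/cplx_mx map_mxM -!/(cplx_mx _) -ctrmx_cplx !mulmxA -ctrmxM -mulmxA.
by rewrite cenorm_ctrmx lecR sqr_ge0.
Qed.

(* With V the Lyapunov function of H and W the one of the identity,
   t V(t) + C W(t) is nonincreasing for C large, so V(t) = O(1/t). *)
Lemma lyapunov_decay (R : realType) n k (F P : 'M[R]_n) (H : 'M[R]_(k, n))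
    (w : R -> 'cV[R]_n) :
  stable F -> F^T *m P + P *m F = - (H^T *m H) ->
  (forall i, C1_on (fun t => w t i 0) (fun t => (F *m w t) i 0)) ->
  ((w t)^T *m P *m w t) 0 0 @[t --> +oo] --> (0 : R).
Proof.
move=> sF hP hw; have [P1 hP1] := lyapunov_exists (- ((1%:M)^T *m 1%:M)) sF.
pose V t := ((w t)^T *m P *m w t) 0 0; pose W t := ((w t)^T *m P1 *m w t) 0 0.
pose C := \sum_i \sum_j `|P i j|.
have C0 : 0 <= C by apply: sumr_ge0 => i _; apply: sumr_ge0 => j _.
have V0 t : 0 <= V t by exact: observability_ge0 sF hP.
have W0 t : 0 <= W t by exact: observability_ge0 sF hP1.
have hV := C1_on_quad P hw; have hW := C1_on_quad P1 hw.
have hg := C1_on_add (C1_on_mul (C1_on_id R) hV) (C1_on_mul (C1_on_cst C) hW).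
have le t : 0 < t -> t * V t <= C * W 0.
  move=> t0; have := C1_on_nonincreasing hg _ (ltW t0).
  rewrite mul0r add0r => h; apply: (@le_trans _ _ (t * V t + C * W t)).
    by rewrite lerDl mulr_ge0.
  apply: h => {t0}t t0 /=; rewrite hP hP1 trmx1 mul1mx !mulmxN !mulNmx mulmx1 mul0r add0r mul1r.
  have oppE (M : 'M[R]_1) : (- M) 0 0 = - (M 0 0) by rewrite mxE.
  have HE : ((w t)^T *m (H^T *m H) *m w t) 0 0 = enorm (H *m w t) ^+ 2.
    by rewrite enorm_sqr trmx_mul !mulmxA.
  (* The derivative is V - t |H w|^2 - C |w|^2, and V <= C |w|^2. *)
  rewrite !oppE HE -enorm_sqr.
  have := quad_le_enorm P (w t); have := mulr_ge0 (ltW t0) (sqr_ge0 (enorm (H *m w t))).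
  by rewrite -/C; move: (enorm _ ^+ 2) (enorm _ ^+ 2) (_ 0 0) => a b c; lra.
apply/cvgrPdist_lt => e e0; near=> t.
rewrite sub0r normrN -/(V t) ger0_norm //.
have t0 : 0 < t by near: t; apply: nbhs_pinfty_gt; exact: num_real.
rewrite -(ltr_pM2l t0) (le_lt_trans (le t t0)) // -ltr_pdivrMr //.
by near: t; apply: nbhs_pinfty_gt; exact: num_real.
Unshelve. all: by end_near. Qed.

(** Along the trajectory V = w^T P w has derivative -|H w|^2 and tends to 0, so integrating over the
    half-line leaves V(0). *)
Lemma L2norm_linear (R : realType) n k (F P : 'M[R]_n) (H : 'M[R]_(k, n))
    (w : R -> 'cV[R]_n) :
  stable F -> F^T *m P + P *m F = - (H^T *m H) ->
  (forall i, C1_on (fun t => w t i 0) (fun t => (F *m w t) i 0)) ->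
  L2norm (fun t => H *m w t) = (Num.sqrt (((w 0)^T *m P *m w 0) 0 0))%:E.
Proof.
move=> sF hP hw; pose V t := ((w t)^T *m P *m w t) 0 0.
pose f t := enorm (H *m w t) ^+ 2.
have fE t : f t = ((w t)^T *m (H^T *m H) *m w t) 0 0.
  by rewrite /f enorm_sqr trmx_mul !mulmxA.
have hV : C1_on V (fun t => - f t).
  apply: C1_on_ext (C1_on_quad P hw) => // t.
  by rewrite hP fE mulmxN mulNmx mxE.
have cf : {within `[0, +oo[, continuous f}.
  by have [cq _] := C1_on_quad (H^T *m H) hw; have /funext fE' := fE; rewrite fE'.
have int : (\int[lebesgue_measure]_(t in `[0%R, +oo[) (f t)%:E = (V 0)%:E)%E.
  have [cV dV] := hV.
  have cNV : {within `[0, +oo[, continuous (fun t : R => - V t)}.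
    by move=> t; apply: cvgN; exact: cV.
  have dNV (t : R) : 0 < t -> is_derive t 1 (fun t : R => - V t) (f t).
    by move=> t0; rewrite -[f t]opprK; apply: is_deriveN; exact: dV.
  rewrite (@ge0_continuous_FTC2y _ f (fun t : R => - V t) 0 0) //.
  - by rewrite -EFinB sub0r opprK.
  - by move=> t _; exact: sqr_ge0.
  - by rewrite -oppr0; apply: cvgN; exact: lyapunov_decay sF hP hw.
  - by move=> t t0; have := dNV t t0; case.
  - by have /continuous_within_itvcyP[] := cNV.
  - move=> t; rewrite in_itv /= andbT => t0; rewrite derive1E.
    by have h := dNV t t0; rewrite (@derive_val _ _ _ _ _ _ _ h).
have V0 : 0 <= V 0 by exact: observability_ge0 sF hP.
rewrite /L2norm unlock /= -/(V 0) -powR12_sqrt //.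
(* The truncated function vanishes at negative times, and so does its square, so the integral
   reduces to the half-line. *)
have -> : (\int[lebesgue_measure]_t
    (`|(((fun t => enorm (H *m w t)) \_ `[0%R, +oo[%classic) t)%:E| `^ 2) = (V 0)%:E)%E.
  rewrite -int [RHS]integral_mkcond; apply: eq_integral => t _ /=.
  rewrite powR_mulrn // real_normK ?num_real // !patchE.
  by case: ifPn => //; rewrite expr0n.
by rewrite poweR_EFin.
Qed.

(** Carries a bound at each frequency over to a single trajectory, so the hypothesis concerns just
    the resolvent applied to [w 0]. Both norms are square roots of Lyapunov forms at [w 0], and
    [frequency_nonneg] compares the forms. *)
Lemma L2_gain (R : realType) n k l (F : 'M[R]_n) (H : 'M[R]_(k, n)) (U : 'M[R]_(l, n))
    (w : R -> 'cV[R]_n) (alpha eps : R) :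
  stable F -> (forall i, C1_on (fun t => w t i 0) (fun t => (F *m w t) i 0)) ->
  0 <= alpha ->
  (forall om (r : 'cV[R[i]]_n), ((Complex 0 om)%:M - cplx_mx F) *m r = cplx_mx (w 0) ->
    cenorm (cplx_mx H *m r) <= alpha * cenorm (cplx_mx U *m r)) ->
  (L2norm (fun t => U *m w t) <= eps%:E)%E ->
  (L2norm (fun t => H *m w t) <= (alpha * eps)%:E)%E.
Proof.
move=> sF hw a0 hf.
have [PH hPH] := lyapunov_exists (- (H^T *m H)) sF.
have [PU hPU] := lyapunov_exists (- (U^T *m U)) sF.
rewrite (L2norm_linear sF hPH hw) (L2norm_linear sF hPU hw) !lee_fin => hU.
apply: le_trans (_ : alpha * Num.sqrt (((w 0)^T *m PU *m w 0) 0 0) <= _);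
  last by rewrite ler_wpM2l.
rewrite -{1}(ger0_norm a0) -sqrtr_sqr -sqrtrM ?sqr_ge0 // ler_wsqrtr // -subr_ge0.
have -> : alpha ^+ 2 * ((w 0)^T *m PU *m w 0) 0 0 - ((w 0)^T *m PH *m w 0) 0 0 =
    ((w 0)^T *m (alpha ^+ 2 *: PU - PH) *m w 0) 0 0.
  rewrite mulmxBr mulmxBl -scalemxAr -scalemxAl.
  by move: (_ *m w 0) (_ *m w 0) => x y; rewrite !mxE.
apply: (@frequency_nonneg _ _ F _ (alpha ^+ 2 *: (U^T *m U) - H^T *m H)) => //.
  rewrite mulmxBr mulmxBl -scalemxAr -scalemxAl addrACA -scalerDr -opprD hPU hPH.
  by rewrite scalerN opprB opprK addrC.
move=> om r hr.
have q m (M : 'M[R]_(m, n)) : (ctrmx r *m cplx_mx (M^T *m M) *m r) 0 0 =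
    (cenorm (cplx_mx M *m r) ^+ 2)%:C%C.
  rewrite {1}/cplx_mx map_mxM -!/(cplx_mx _) -ctrmx_cplx !mulmxA -ctrmxM -mulmxA.
  by rewrite cenorm_ctrmx.
have -> : cplx_mx (alpha ^+ 2 *: (U^T *m U) - H^T *m H) =
    (alpha ^+ 2)%:C%C *: cplx_mx (U^T *m U) - cplx_mx (H^T *m H).
  by rewrite /cplx_mx map_mxB map_mxZ.
have subE (x y : 'M[R[i]]_1) : (x - y) 0 0 = x 0 0 - y 0 0 by rewrite !mxE.
have sclE c (x : 'M[R[i]]_1) : (c *: x) 0 0 = c * x 0 0 by rewrite mxE.
rewrite mulmxBr mulmxBl -scalemxAr -scalemxAl subE sclE !q -rmorphM -rmorphB lecR subr_ge0.
rewrite -exprMn ler_pXn2r ?nnegrE ?mulr_ge0 ?cenorm_ge0 //.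
exact: hf hr.
Qed.

(** * Stability and transfer matrices of the closed loop *)

(** For a row eigenvector (a, b, c), adding the first and third block columns shows that (a + c, b)
    is a row eigenvector of the preexisting matrix, unless it vanishes; then [a] is one of A1 + B1
    K1 C1. *)
Lemma closed_loop_stable (R : realType) n1 n2 m p q r
    (A1 : 'M[R]_n1) (B1 : 'M[R]_(n1, m)) (C1 : 'M[R]_(p, n1))
    (L1 : 'M[R]_(n1, q)) (A2 : 'M[R]_n2) (L2 : 'M[R]_(n2, r))
    (Gamma1 : 'M[R]_(r, n1)) (Gamma2 : 'M[R]_(q, n2)) (K1 : 'M[R]_(m, p)) :
  stable (preexisting_mx A1 L1 A2 L2 Gamma1 Gamma2) ->
  stable (A1 + B1 *m K1 *m C1) ->
  stable (closed_loop_mx A1 B1 C1 L1 A2 L2 Gamma1 Gamma2 K1).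
Proof.
move=> sA sM z /eigenvalueP[u].
rewrite -[u]hsubmxK -[lsubmx u]hsubmxK.
move: (lsubmx (lsubmx u)) (rsubmx (lsubmx u)) (rsubmx u) => a b c.
rewrite /closed_loop_mx /cplx_mx !map_block_mx map_col_mx map_row_mx !map_mx0.
rewrite map_mxN !mul_row_block !mul_row_col mul_mx_row !scale_row_mx !mulmx0 addr0.
rewrite mulmxN add_row_mx addr0 !map_mxD.
move=> /eq_row_mx[/eq_row_mx[ea eb] ec] u0.
set fA1 := map_mx _ A1 in ea ec; set fLG := map_mx _ (L1 *m _) in eb ec.
set fGL := map_mx _ (L2 *m _) in ea; set fA2 := map_mx _ A2 in eb.
set fK := map_mx _ (_ *m _) in ea ec.
have h1 : (a + c) *m fA1 + b *m fGL = z *: (a + c).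
  rewrite scalerDr -ea -ec mulmxDr mulmxDl.
  by apply/matrixP => i j; rewrite !mxE; ring.
have h2 : (a + c) *m fLG + b *m fA2 = z *: b.
  by rewrite -eb mulmxDl addrAC.
have [ac0|ac0] := eqVneq (row_mx (a + c) b) 0.
  move: ac0; rewrite -row_mx0 => /eq_row_mx[ac b0].
  apply: sM; apply/eigenvalueP; exists a.
    by move: ea; rewrite b0 mul0mx addr0 /cplx_mx map_mxD.
  apply: contraNneq u0 => a0; move: ac; rewrite a0 add0r => ->.
  by rewrite b0 !row_mx0.
apply: sA; apply/eigenvalueP; exists (row_mx (a + c) b) => //.
by rewrite /preexisting_mx /cplx_mx map_block_mx mul_row_block scale_row_mx h1 h2.
Qed.

Lemma transfer_bounded (R : realType) n1 n2 r k (E : 'M[R]_(n1 + n2, k))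
    (A : 'M[R]_(n1 + n2)) (L2 : 'M[R]_(n2, r)) (Gamma1 : 'M[R]_(r, n1)) :
  stable A -> exists2 K : R, 0 <= K & forall w (z : 'cV[R[i]]_n1),
    cenorm (transfer E A L2 Gamma1 (Complex 0 w) *m z) <= K * cenorm z.
Proof.
move=> sA; have [K K0 hK] := resolvent_bounded sA.
have S0 m n (M : 'M[R[i]]_(m, n)) : 0 <= \sum_i \sum_j normc (M i j).
  by apply: sumr_ge0 => i _; apply: sumr_ge0 => j _; exact: normc_ge0.
set B := cplx_mx (E2 R n1 n2 *m L2 *m Gamma1).
exists ((\sum_i \sum_j normc (cplx_mx E^T i j)) * (K * \sum_i \sum_j normc (B i j))).
  by rewrite !mulr_ge0.
move=> w z; rewrite /transfer -/B -!mulmxA; apply: le_trans (cenorm_mulmx _ _) _.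
rewrite -!mulrA ler_wpM2l //.
apply: le_trans (hK w _ (B *m z) _) _; last by rewrite ler_wpM2l // cenorm_mulmx.
by rewrite mulKVmx //; exact: (resolvent_unit (s := Complex 0 w) sA (lexx 0)).
Qed.

Lemma Hinf_norm_gain (R : realType) m n (G : R[i] -> 'M[R[i]]_(m, n)) (K : R) :
  0 <= K -> (forall w z, cenorm (G (Complex 0 w) *m z) <= K * cenorm z) ->
  [/\ Hinf_norm G \is a fin_num, 0 <= fine (Hinf_norm G) &
   forall w z, cenorm (G (Complex 0 w) *m z) <= fine (Hinf_norm G) * cenorm z].
Proof.
move=> K0 hK; have [|f h] := @Hinf_norm_fin _ _ _ G K.
  by move=> w; exact: opnorm_le.
split=> // [|w z]; first exact: le_trans (opnorm_ge0 _) (h 0).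
by apply: le_trans (cenorm_opnorm _ _) _; rewrite ler_wpM2r ?cenorm_ge0.
Qed.

(* In the coordinates (x1, x2, xh1) = (a, b, c), the error a - c drives
   the preexisting system, whose state is then (c, b). *)
Lemma closed_loop_transfer (R : realType) n1 n2 m p q r
    (A1 : 'M[R]_n1) (B1 : 'M[R]_(n1, m)) (C1 : 'M[R]_(p, n1))
    (L1 : 'M[R]_(n1, q)) (A2 : 'M[R]_n2) (L2 : 'M[R]_(n2, r))
    (Gamma1 : 'M[R]_(r, n1)) (Gamma2 : 'M[R]_(q, n2)) (K1 : 'M[R]_(m, p))
    (s : R[i]) (a c d : 'cV[R[i]]_n1) (b : 'cV[R[i]]_n2) :
  let A := preexisting_mx A1 L1 A2 L2 Gamma1 Gamma2 in
  s%:M - cplx_mx A \in unitmx ->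
  (s%:M - cplx_mx (closed_loop_mx A1 B1 C1 L1 A2 L2 Gamma1 Gamma2 K1)) *m
    col_mx (col_mx a b) c = col_mx (col_mx d 0) 0 ->
  a = (transfer (E1 R n1 n2) A L2 Gamma1 s + 1%:M) *m (a - c) /\
  b = transfer (E2 R n1 n2) A L2 Gamma1 s *m (a - c).
Proof.
move=> A uA; rewrite mulmxBl mul_scalar_mx /closed_loop_mx /cplx_mx !map_block_mx.
rewrite map_col_mx map_row_mx !map_mx0 map_mxN !mul_block_col mul_col_mx.
rewrite mul_row_col !mul0mx add0r add_col_mx addr0 !scale_col_mx !opp_col_mx !add_col_mx.
move=> /eq_col_mx[/eq_col_mx[_ /eqP + ] /eqP].
rewrite !subr_eq0 => /eqP eb /eqP ec.
have h : (s%:M - cplx_mx A) *m col_mx c b =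
    cplx_mx (E2 R n1 n2 *m L2 *m Gamma1) *m (a - c).
  rewrite mulmxBl mul_scalar_mx /A /preexisting_mx /cplx_mx map_block_mx mul_block_col.
  rewrite scale_col_mx opp_col_mx add_col_mx /E2 -mulmxA mul_col_mx mul0mx mul1mx map_col_mx.
  rewrite map_mx0 mul_col_mx mul0mx eb ec mulmxBr; congr col_mx.
    by rewrite [X in _ - X]addrC subrr.
  by rewrite opprD addrACA subrr addr0.
have {}h : col_mx c b = invmx (s%:M - cplx_mx A) *m
    (cplx_mx (E2 R n1 n2 *m L2 *m Gamma1) *m (a - c)) by rewrite -h mulKmx.
rewrite /transfer mulmxDl mul1mx; move: (cplx_mx (_ *m Gamma1)) h => B h.
rewrite -!mulmxA -h /E1 /E2 !tr_col_mx !trmx1 !trmx0.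
rewrite /cplx_mx !map_row_mx !map_mx1 !map_mx0 !mul_row_col !mul1mx !mul0mx addr0 add0r.
by rewrite addrC subrK.
Qed.

(** * Closed-loop trajectories and the final bounds *)

Lemma solves_sub (R : realType) n (x y v u : R -> 'cV[R]_n) :
  solves x v -> solves y u -> solves (fun t => x t - y t) (fun t => v t - u t).
Proof.
move=> [cx hx] [cy hy]; split; first by move=> t; apply: cvgB; [exact: cx|exact: cy].
by move=> t t0; apply: is_deriveB; [exact: hx|exact: hy].
Qed.

Lemma solves_eq (R : realType) n (x v u : R -> 'cV[R]_n) :
  (forall t, 0 < t -> v t = u t) -> solves x v -> solves x u.
Proof. by move=> vu [cx hx]; split=> // t t0; rewrite -vu //; exact: hx. Qed.

Lemma C1_on_col_mx (R : realType) m n (x v : R -> 'cV[R]_m) (y u : R -> 'cV[R]_n) :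
  (forall i, C1_on (fun t => x t i 0) (fun t => v t i 0)) ->
  (forall i, C1_on (fun t => y t i 0) (fun t => u t i 0)) ->
  forall i, C1_on (fun t => col_mx (x t) (y t) i 0) (fun t => col_mx (v t) (u t) i 0).
Proof.
move=> hx hy i; case: (split_ordP i) => j ->.
  by apply: C1_on_ext (hx j) => t; rewrite col_mxEu.
by apply: C1_on_ext (hy j) => t; rewrite col_mxEd.
Qed.

Unset Implicit Arguments.

Theorem theorem2p1 (R : realType) (n1 n2 m p q r : nat)
    (A1 : 'M[R]_n1) (B1 : 'M[R]_(n1, m)) (C1 : 'M[R]_(p, n1))
    (L1 : 'M[R]_(n1, q)) (A2 : 'M[R]_n2) (L2 : 'M[R]_(n2, r))
    (Gamma1 : 'M[R]_(r, n1)) (Gamma2 : 'M[R]_(q, n2)) :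
  let A := preexisting_mx A1 L1 A2 L2 Gamma1 Gamma2 in
  let G1 := transfer (E1 R n1 n2) A L2 Gamma1 in
  let G2 := transfer (E2 R n1 n2) A L2 Gamma1 in
  let alpha1 := Hinf_norm (fun s => G1 s + 1%:M) in
  let alpha2 := Hinf_norm G2 in
  stable A ->
  [/\ alpha1 \is a fin_num, alpha2 \is a fin_num &
   forall (eps1 : R) (K1 : 'M[R]_(m, p)),
     0 < eps1 ->
     stable (A1 + B1 *m K1 *m C1) ->
     (forall xi1 : R -> 'cV[R]_n1,
        solves xi1 (fun t => (A1 + B1 *m K1 *m C1) *m xi1 t) ->
        enorm (xi1 0) <= 1 ->
        (L2norm xi1 <= eps1%:E)%E) ->
     stable (closed_loop_mx A1 B1 C1 L1 A2 L2 Gamma1 Gamma2 K1) /\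
     (forall (delta0 : 'cV[R]_n1)
        (x1 xh1 : R -> 'cV[R]_n1) (x2 : R -> 'cV[R]_n2)
        (u1 : R -> 'cV[R]_m) (gamma2 : R -> 'cV[R]_q) (y1 : R -> 'cV[R]_p),
        enorm delta0 <= 1 ->
        Sigma A1 B1 C1 L1 A2 L2 Gamma1 Gamma2 delta0 u1 x1 x2 gamma2 y1 ->
        Pi1 A1 C1 L1 K1 gamma2 y1 xh1 u1 ->
        (L2norm x1 <= alpha1 * eps1%:E)%E /\
        (L2norm x2 <= alpha2 * eps1%:E)%E)].
Proof.
move=> A G1 G2 alpha1 alpha2 sA.
have [K K0 hK] := transfer_bounded (E1 R n1 n2) L2 Gamma1 sA.
have [K' K'0 hK'] := transfer_bounded (E2 R n1 n2) L2 Gamma1 sA.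
(* The constant comes from [cenormD_le] applied to G1 z + z; it certifies finiteness, while the gain
   retained in [g1] is the norm itself. *)
have [|w z|f1 a1 g1] := @Hinf_norm_gain _ _ _ (fun s => G1 s + 1%:M) (n1%:R * (K + 1)).
- by rewrite mulr_ge0 // addr_ge0.
- rewrite mulmxDl mul1mx (le_trans (cenormD_le _ _)) // -mulrA ler_wpM2l //.
  by rewrite mulrDl mul1r lerD2r.
have [f2 a2 g2] := Hinf_norm_gain K'0 hK'.
split=> // eps1 K1 e0 sM hM.
have sF := closed_loop_stable sA sM; split=> // delta0 x1 xh1 x2 u1 gamma2 y1 d1.
move=> [hx1 hx2 hg hy [x10 x20]] [hxh hu xh0].
set F := closed_loop_mx _ _ _ _ _ _ _ _ _ in sF.
pose w t := col_mx (col_mx (x1 t) (x2 t)) (xh1 t).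
have hx1' : solves x1 (fun t => A1 *m x1 t + L1 *m (Gamma2 *m x2 t) +
    B1 *m (K1 *m (C1 *m x1 t - C1 *m xh1 t))).
  by apply: solves_eq hx1 => t /ltW t0; rewrite hg // hu // hy.
have hxh' : solves xh1 (fun t => A1 *m xh1 t + L1 *m (Gamma2 *m x2 t)).
  by apply: solves_eq hxh => t /ltW t0; rewrite hg.
have hw i : C1_on (fun t => w t i 0) (fun t => (F *m w t) i 0).
  rewrite [X in C1_on _ X](_ : _ = fun t => col_mx (col_mx
      (A1 *m x1 t + L1 *m (Gamma2 *m x2 t) + B1 *m (K1 *m (C1 *m x1 t - C1 *m xh1 t)))
      (A2 *m x2 t + L2 *m Gamma1 *m x1 t)) (A1 *m xh1 t + L1 *m (Gamma2 *m x2 t)) i 0).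
    apply: C1_on_col_mx => j; last exact: solves_coord hxh'.
    by apply: C1_on_col_mx => k; [exact: solves_coord hx1'|exact: solves_coord hx2].
  by apply/funext => t; rewrite closed_loop_mxE.
pose U : 'M[R]_(n1, n1 + n2 + n1) := row_mx (row_mx 1%:M 0) (- 1%:M).
pose H1 : 'M[R]_(n1, n1 + n2 + n1) := row_mx (row_mx 1%:M 0) 0.
pose H2 : 'M[R]_(n2, n1 + n2 + n1) := row_mx (row_mx 0 1%:M) 0.
have he : (L2norm (fun t => U *m w t) <= eps1%:E)%E.
  have -> : (fun t => U *m w t) = (fun t => x1 t - xh1 t).
    by apply/funext => t; rewrite !mul_row_col mul1mx mul0mx addr0 mulNmx mul1mx.
  (* In x1 - xh1 the terms L1 gamma2 cancel, leaving a solution of the dynamics assumed for [K1],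
     started at [delta0]. *)
  apply: hM; last by rewrite x10 xh0 subr0.
  apply: solves_eq (solves_sub hx1' hxh') => t _.
  rewrite mulmxDl !mulmxBr !mulmxA.
  by apply/matrixP => i j; rewrite !mxE; ring.
have hr om (rr : 'cV[R[i]]_(n1 + n2 + n1)) :
    ((Complex 0 om)%:M - cplx_mx F) *m rr = cplx_mx (w 0) ->
    cplx_mx H1 *m rr = (G1 (Complex 0 om) + 1%:M) *m (cplx_mx U *m rr) /\
    cplx_mx H2 *m rr = G2 (Complex 0 om) *m (cplx_mx U *m rr).
  rewrite -[rr]vsubmxK -[usubmx rr]vsubmxK.
  move: (usubmx (usubmx rr)) (dsubmx (usubmx rr)) (dsubmx rr) => a b c.
  (* Both x2 and xh1 start at 0, which is the form of the right-hand side that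
     [closed_loop_transfer] requires. *)
  have -> : cplx_mx (w 0) = col_mx (col_mx (cplx_mx (x1 0)) 0) 0.
    by rewrite /w x20 xh0 /cplx_mx !map_col_mx !map_mx0.
  move=> h.
  have -> : cplx_mx U *m col_mx (col_mx a b) c = a - c.
    rewrite /U /cplx_mx !map_row_mx map_mxN map_mx1 map_mx0 !mul_row_col.
    by rewrite mulNmx !mul1mx mul0mx addr0.
  have -> : cplx_mx H1 *m col_mx (col_mx a b) c = a.
    by rewrite /H1 /cplx_mx !map_row_mx map_mx1 !map_mx0 !mul_row_col mul1mx !mul0mx !addr0.
  have -> : cplx_mx H2 *m col_mx (col_mx a b) c = b.
    by rewrite /H2 /cplx_mx !map_row_mx map_mx1 !map_mx0 !mul_row_col mul1mx !mul0mx addr0 add0r.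
  exact: (closed_loop_transfer (resolvent_unit (s := Complex 0 om) sA (lexx 0)) h).
have -> : x1 = (fun t => H1 *m w t).
  by apply/funext => t; rewrite !mul_row_col mul1mx !mul0mx !addr0.
have -> : x2 = (fun t => H2 *m w t).
  by apply/funext => t; rewrite !mul_row_col mul1mx !mul0mx addr0 add0r.
rewrite /alpha1 /alpha2 -(fineK f1) -(fineK f2) -!EFinM; split.
  apply: L2_gain sF hw a1 _ he => om rr /hr[-> _]; exact: g1.
by apply: L2_gain sF hw a2 _ he => om rr /hr[_ ->]; exact: g2.
Qed.
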